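(* For all integers $0 \leq k \leq n$, $\mathrm{er}(n,k) \leq \mathrm{frst}(n,k)$.
   Context: For $0 \leq k \leq n$: $\Omega_{n,k}$ is the set of words $v=v_1\cdots v_n$ over $\{0,1\}$ with $n-k$ zeroes and $k$ ones; $\Omega''_{n,k}$ is the set of $v \in \Omega_{n,k}$ with $v_1 \leq v_2$, $v_3 \leq v_4$, $\ldots$, $v_{2\lfloor n/2\rfloor-1} \leq v_{2\lfloor n/2\rfloor}$ (no condition on $v_n$ for $n$ odd); and $\mathrm{er}(n,k)=|\Omega''_{n,k}|$. A weak partition is a finite non-decreasing sequence of non-negative integers; $\mathrm{frst}(n,k)$ is the number of weak partitions with exactly $n-k$ parts, each part at most $k$, such that: (a) if $k$ is even, each odd part has even multiplicity; (b) if $k$ is odd, each even part (including $0$) has even multiplicity. *)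

(* Defs.v *)
From mathcomp Require Import all_boot.

Set Implicit Arguments.
Unset Strict Implicit.
Unset Printing Implicit Defensive.

(* The letters 0 and 1 are encoded as false and true; the order between letters
   is that of their images under the coercion from bool to nat. *)
Definition Omega (n k : nat) : {set n.-tuple bool} :=
  [set v : n.-tuple bool |
     (count_mem false v == n - k) && (count_mem true v == k)].

(* Positions are numbered from 0, so the i-th pair (i < n./2) consists of the
   letters in positions i.*2 and i.*2.+1; both are within bounds. *)
Definition Omega'' (n k : nat) : {set n.-tuple bool} :=
  [set v in Omega n k |
     [forall i : 'I_n./2, nth false v i.*2 <= nth false v i.*2.+1]].

Definition er (n k : nat) : nat := #|Omega'' n k|.

(* The values 0, ..., k of the parts are the elements of 'I_k.+1. *)
Definition frst_partitions (n k : nat) : {set (n - k).-tuple 'I_k.+1} :=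
  [set s : (n - k).-tuple 'I_k.+1 |
     sorted leq (map val s) &&
     (if odd k then
        all (fun p : 'I_k.+1 => ~~ odd p ==> ~~ odd (count_mem p s)) s
      else
        all (fun p : 'I_k.+1 => odd p ==> ~~ odd (count_mem p s)) s)].

Definition frst (n k : nat) : nat := #|frst_partitions n k|.

(* Main.v *)
Require Import Defs.
From mathcomp Require Import all_boot.

(** Read the word two letters at a time, from the right, and build a partition:
    the pair 00 adds two parts 0; the pair 01 raises all parts by 1 and adds one
    part equal to the parity of the number k of ones read so far; the pair 11
    raises all parts by 2.  The parts whose parity differs from that of k keep an
    even multiplicity.  The last pair read can be recovered from the two smallest
    parts: 0, 0 for 00; 1, or 0 followed by a positive part, for 01 (according to
    the parity of k); no part below 2 for 11.  So the map is injective. *)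

Set Implicit Arguments.
Unset Strict Implicit.
Unset Printing Implicit Defensive.

Fixpoint pairs_le (w : seq bool) : bool :=
  if w is a :: b :: w' then (a <= b) && pairs_le w' else true.

(** In odd length the last letter is unpaired and free: 0 starts with one part 0, 1 with no part.
    The pair 10, treated like 11, is excluded by [pairs_le]. *)
Fixpoint word_partition (w : seq bool) : seq nat :=
  match w with
  | a :: b :: w' =>
    let s := word_partition w' in
    if a then map (addn 2) s
    else if b then (~~ odd (count_mem true w') : nat) :: map (addn 1) s
    else 0 :: 0 :: s
  | [:: false] => [:: 0]
  | _ => [::]
  end.

Lemma seq_ind2_step (T : Type) (P : seq T -> Prop) :
  P [::] -> (forall x, P [:: x]) ->
  (forall x y s, P s -> P (x :: y :: s)) -> forall s, P s.
Proof.
move=> P0 P1 P2 s; suff: P s /\ forall x, P (x :: s) by case.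
by elim: s => [|y s [IHs IHys]]; split=> // x; apply: P2.
Qed.

Lemma pairs_leP (w : seq bool) :
  (forall i, i < (size w)./2 -> nth false w i.*2 <= nth false w i.*2.+1) ->
  pairs_le w.
Proof.
elim/seq_ind2_step: w => // a b w IH H /=.
by rewrite (H 0) //=; apply: IH => i lti; apply: (H i.+1).
Qed.

Lemma size_word_partition (w : seq bool) :
  pairs_le w -> size (word_partition w) = count_mem false w.
Proof.
elim/seq_ind2_step: w => [|[]|[] [] w IH] //= /IH <-; rewrite ?size_map //.
Qed.

Lemma sorted_map_addn (m : nat) (s : seq nat) :
  sorted leq s -> sorted leq (map (addn m) s).
Proof. by apply: homo_sorted => x y; rewrite leq_add2l. Qed.

Lemma sorted_cons_leq (x : nat) (s : seq nat) :
  all (leq x) s -> sorted leq s -> sorted leq (x :: s).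
Proof. by move=> h hs /=; rewrite path_sortedE ?h //; apply: leq_trans. Qed.

Lemma word_partition_sorted (w : seq bool) :
  sorted leq (word_partition w).
Proof.
elim/seq_ind2_step: w => [|[]|[] b w IH] //; first exact: sorted_map_addn.
case: b; rewrite [word_partition _]/=.
  apply: sorted_cons_leq (sorted_map_addn 1 IH).
  (* The new part is at most 1, and every raised part is at least 1. *)
  by apply/allP => _ /mapP[x _ ->]; case: odd.
by do 2!(apply: sorted_cons_leq; first exact/allP).
Qed.

Lemma word_partition_bounded (w : seq bool) :
  pairs_le w -> all (fun p => p <= count_mem true w) (word_partition w).
Proof.
elim/seq_ind2_step: w => [|[]|[] [] w IH] //= /IH /allP H.
- by apply/allP => _ /mapP[x /H hx ->]; rewrite addnA leq_add2l.
- apply/andP; split; first by case: odd.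
  by apply/allP => _ /mapP[x /H hx ->]; rewrite add0n leq_add2l.
Qed.

Lemma count_mem_map_addn (m p : nat) (s : seq nat) :
  count_mem p (map (addn m) s) = if m <= p then count_mem (p - m) s else 0.
Proof.
rewrite count_map; case: leqP => h.
  by apply: eq_count => x /=; rewrite -{1}(subnKC h) eqn_add2l.
rewrite (eq_count (a2 := pred0)) ?count_pred0 // => x /=.
by apply/eqP => e; move: h; rewrite -e ltnNge leq_addr.
Qed.

Lemma word_partition_parity (w : seq bool) (p : nat) :
  pairs_le w -> odd p != odd (count_mem true w) ->
  ~~ odd (count_mem p (word_partition w)).
Proof.
elim/seq_ind2_step: w p => [|[]|[] [] w IH] p //=.
- by case: p.
- move=> /IH {}IH; rewrite count_mem_map_addn negbK.
  case: p => [|[|p]] //=; rewrite ?subSS subn0 negbK; exact: IH.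
- move=> /IH {}IH; rewrite count_mem_map_addn add0n /=.
  (* If [p = 0], the number of ones, including the one just read, is odd: the new part is 1 and no
     part is 0. *)
  case: p => [|p] /=; first by case: odd.
  (* Raised parts equal to [p.+1] come from parts [p]; both parities flip, so induction applies. The
     new part has the parity of the number of ones, hence is not [p.+1]. *)
  rewrite subSS subn0 oddD => h.
  rewrite (negbTE (IH p _)); last by move: h; do 2!case: odd.
  by move: h; case: (odd (count_mem _ _)); case: p.
- by move=> /IH {}IH; rewrite !add0n => /IH; rewrite addnA oddD; case: (0 == p).
Qed.

(** Equal sizes let the words be compared pair by pair; without them, the empty word and 11 would
    both give the empty partition. *)
Lemma word_partition_inj (v w : seq bool) :
  size v = size w -> count_mem true v = count_mem true w ->
  pairs_le v -> pairs_le w ->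
  word_partition v = word_partition w -> v = w.
Proof.
(* This separates different pairs: [m = 2] tells 11 from 01 and 00 by the first part, [m = 1] tells
   01 from 00 by the second. *)
have neq_map m (b : bool) s t : b < m -> map (addn m) s <> (b : nat) :: t.
  by move=> ltbm; case: s => //= x s [e _]; move: ltbm; rewrite -e ltnNge leq_addr.
elim/seq_ind2_step: v w => [[]|[] [|[] []]|a b v IH [|c [|d w]]] //.
case: a; case: b => //; case: c; case: d => //= -[sz]; rewrite ?add0n ?add1n.
- move=> [ct] vP wP /inj_map e.
  by congr [:: _, _ & _]; apply: IH => //; apply: e; apply: addnI.
- by move=> _ _ _ /neq_map; case; case: odd.
- by move=> _ _ _ /(neq_map 2 false _ _ isT).
- by move=> _ _ _ /esym/neq_map; case; case: odd.
- move=> [ct] vP wP [_ /inj_map e].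
  by congr [:: _, _ & _]; apply: IH => //; apply: e; apply: addnI.
- by move=> _ _ _ [_ /(neq_map 1 false _ _ isT)].
- by move=> _ _ _ /esym/(neq_map 2 false _ _ isT).
- by move=> _ _ _ [_ /esym/(neq_map 1 false _ _ isT)].
- by move=> ct vP wP [e]; rewrite (IH w).
Qed.

Theorem theorem3p6 (n k : nat) (hkn : k <= n) : er n k <= frst n k.
Proof.
(* The default tuple and the default of [inord] only make [f] total: on [Omega'' n k] the size is
   [n - k] and the parts are at most [k]. *)
pose f (v : n.-tuple bool) : (n - k).-tuple 'I_k.+1 :=
  insubd (nseq_tuple (n - k) ord0) (map inord (word_partition v)).
have OmegaP v : v \in Omega'' n k ->
    [/\ pairs_le v, count_mem false v = n - k & count_mem true v = k].
  rewrite !inE => /andP[/andP[/eqP-> /eqP->] /forallP H]; split=> //.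
  by apply: pairs_leP => i; rewrite size_tuple => lti; apply: (H (Ordinal lti)).
have val_f v : v \in Omega'' n k -> map val (f v) = word_partition v.
  move=> /OmegaP[vP c0 c1].
  rewrite val_insubd size_map size_word_partition // c0 eqxx -map_comp.
  rewrite -[RHS]map_id; apply/eq_in_map => x.
  move/(allP (word_partition_bounded vP)); rewrite c1 => lexk.
  by rewrite /= inordK.
have f_inj : {in Omega'' n k &, injective f}.
  move=> v w hv hw e; apply: val_inj.
  have [vP _ cv] := OmegaP _ hv; have [wP _ cw] := OmegaP _ hw.
  apply: word_partition_inj => //; rewrite ?size_tuple ?cv ?cw //.
  by rewrite -!val_f // e.
rewrite /er /frst -(card_in_imset f_inj); apply/subset_leq_card/subsetP.
move=> _ /imsetP[v hv ->]; have [vP _ cv] := OmegaP _ hv.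
(* Conditions (a) and (b) in one form: parts of parity other than that of [k] have even
   multiplicity. *)
have even_mult (p : 'I_k.+1) : odd p != odd k -> ~~ odd (count_mem p (f v)).
  move=> hp; have := @word_partition_parity _ p vP; rewrite cv => /(_ hp).
  rewrite -val_f // count_map.
  by rewrite (eq_count (a2 := pred1 p)).
rewrite inE val_f // word_partition_sorted /=.
case: ifP => oddk; apply/allP => p _; apply/implyP => hp; apply: even_mult.
  by rewrite oddk; case: odd hp.
by rewrite oddk hp.
Qed.
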